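(* Let $p$ and $q$ be integers such that $p\le -2$, $q\ge4$ and $|q|>|p|+1$. For $s\in\{\alpha,\beta\}$ put $$B^{\pm}_s=\frac{\sqrt[3]{s^{q-3p}}}{(s^qF_p + F_{p+q})^3}\bigg(\sqrt[3]{s^{4q}F_p^4}\pm\sqrt[3]{F^4_{p+q}}\mp 2\sqrt[3]{s^qF_p F_{p+q}}\,\Big(\sqrt[3]{s^{2q}F^2_p}\pm\sqrt[3]{F^2_{p+q}}\Big)\bigg).$$ Let $$T_1=\arctan \bigg( \frac{\sqrt 3\,\sqrt[3]{F_{p + q}}}{2\sqrt[3]{\alpha^q F_p} + \sqrt[3]{F_{p + q}} } \bigg),\quad T_2=\arctan\bigg( \frac{\sqrt 3\sqrt[3]{F_p}}{2(-1)^q\sqrt[3]{\alpha^qF_{p+q}} + \sqrt[3]{F_{p}} } \bigg),$$ $$G_1=\log\bigg( \frac{(-1)^p F_q}{\big(\sqrt[3]{\alpha^pF_{p + q}}- \sqrt[3]{\alpha^{p+q} F_p} \big)^3 }\bigg),\quad G_2=\log\bigg( \frac{\alpha^{p+q} F_q}{\big(\sqrt[3]{\alpha^qF_{p + q}} -(-1)^q \sqrt[3]{F_p}\big)^3} \bigg).$$ Then $$\begin{aligned}\frac{1}{F_q\sqrt[3]{F_pF_{p+q}}}\sum_{k = 1}^\infty (-1)^{k-p}\Big(\frac{27F_p F_{p + q}}{F_q^2} \Big)^{k} \frac{F_{(2p + q)k}}{\binom{3k}{k}} &= \frac{4(-1)^{p-1}\sqrt[3]{F^2_{p+q}F^2_p}\,\big(F^2_{p+q}-(-1)^qF_p^2\big)}{(F_{p+q}+\alpha^qF_p)^2(F_{p+q}+\beta^qF_p)^2}\\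 &\quad - \frac{2\sqrt{15}}{15}\big(B^{+}_{\alpha} T_1 + B^{+}_{\beta} T_2 \big) +\frac{\sqrt5}{15} \big(B^{-}_{\alpha}G_1 - B^{-}_{\beta}G_2 \big),\end{aligned}$$ and $$\begin{aligned}\frac{1}{F_q\sqrt[3]{F_pF_{p+q}}}\sum_{k = 1}^\infty (-1)^{k-p}\Big(\frac{27F_p F_{p + q}}{F_q^2} \Big)^{k} \frac{L_{(2p + q)k}}{\binom{3k}{k}} &= \frac{4(-1)^{p-q-1}\sqrt[3]{F^2_{p+q}F^2_p}}{F_q}\cdot \frac{F^2_pL_q+(-1)^qF^2_{p+q}L_q+4F_pF_{p+q}}{(F_{p+q}+\alpha^qF_p)^2 (F_{p+q}+\beta^qF_p)^2}\\ &\quad - \frac{2}{\sqrt3}\big(B^{+}_{\alpha} T_1 - B^{+}_{\beta} T_2 \big) + \frac{1}{3}\big( B^{-}_{\alpha}G_1 + B^{-}_{\beta}G_2 \big).\end{aligned}$$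
   Context: $F_n$ and $L_n$ are the Fibonacci and Lucas numbers, defined by $F_0=0$, $F_1=1$, $L_0=2$, $L_1=1$, $X_n=X_{n-1}+X_{n-2}$, and extended to negative indices by $F_{-j}=(-1)^{j-1}F_j$, $L_{-j}=(-1)^jL_j$. $\alpha=(1+\sqrt5)/2$, $\beta=(1-\sqrt5)/2$. $\sqrt[3]{t}$ denotes the real cube root (negative for $t<0$). The abbreviations $T_1,T_2,G_1,G_2$ are introduced only to shorten the display; they stand for exactly the expressions written in the paper. *)

(* Defs.v *)
From Stdlib Require Import Reals ZArith.
From Coquelicot Require Import Coquelicot.
Open Scope R_scope.

Fixpoint fibN (n : nat) : R :=
  match n with
  | O => 0
  | S O => 1
  | S ((S m) as n') => fibN n' + fibN m
  end.

Fixpoint lucN (n : nat) : R :=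
  match n with
  | O => 2
  | S O => 1
  | S ((S m) as n') => lucN n' + lucN m
  end.

Definition Fib (z : Z) : R :=
  match z with
  | Z0 => 0
  | Zpos n => fibN (Pos.to_nat n)
  | Zneg n => (-1) ^ (Pos.to_nat n - 1) * fibN (Pos.to_nat n)
  end.

Definition Luc (z : Z) : R :=
  match z with
  | Z0 => 2
  | Zpos n => lucN (Pos.to_nat n)
  | Zneg n => (-1) ^ (Pos.to_nat n) * lucN (Pos.to_nat n)
  end.

Definition alpha : R := (1 + sqrt 5) / 2.
Definition beta : R := (1 - sqrt 5) / 2.

Definition cbrt (t : R) : R :=
  match Rlt_dec 0 t with
  | left _ => Rpower t (1 / 3)
  | right _ =>
      match Rlt_dec t 0 with
      | left _ => - Rpower (- t) (1 / 3)
      | right _ => 0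
      end
  end.

Notation "s ^^ z" := (powerRZ s z) (at level 30, right associativity).

Section Consts.
Variables p q : Z.

Definition Bplus (s : R) : R :=
  cbrt (s ^^ (q - 3 * p)) / (s ^^ q * Fib p + Fib (p + q)) ^ 3 *
  ( cbrt (s ^^ (4 * q) * Fib p ^ 4) + cbrt (Fib (p + q) ^ 4)
    - 2 * cbrt (s ^^ q * Fib p * Fib (p + q)) *
      (cbrt (s ^^ (2 * q) * Fib p ^ 2) + cbrt (Fib (p + q) ^ 2)) ).

Definition Bminus (s : R) : R :=
  cbrt (s ^^ (q - 3 * p)) / (s ^^ q * Fib p + Fib (p + q)) ^ 3 *
  ( cbrt (s ^^ (4 * q) * Fib p ^ 4) - cbrt (Fib (p + q) ^ 4)
    + 2 * cbrt (s ^^ q * Fib p * Fib (p + q)) *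
      (cbrt (s ^^ (2 * q) * Fib p ^ 2) - cbrt (Fib (p + q) ^ 2)) ).

Definition T1 : R :=
  atan (sqrt 3 * cbrt (Fib (p + q)) /
        (2 * cbrt (alpha ^^ q * Fib p) + cbrt (Fib (p + q)))).

Definition T2 : R :=
  atan (sqrt 3 * cbrt (Fib p) /
        (2 * (-1) ^^ q * cbrt (alpha ^^ q * Fib (p + q)) + cbrt (Fib p))).

Definition G1 : R :=
  ln ((-1) ^^ p * Fib q /
      (cbrt (alpha ^^ p * Fib (p + q)) - cbrt (alpha ^^ (p + q) * Fib p)) ^ 3).

Definition G2 : R :=
  ln (alpha ^^ (p + q) * Fib q /
      (cbrt (alpha ^^ q * Fib (p + q)) - (-1) ^^ q * cbrt (Fib p)) ^ 3).

Definition summand (X : Z -> R) (k : nat) : R :=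
  (-1) ^^ (Z.of_nat k - p) *
  (27 * Fib p * Fib (p + q) / Fib q ^ 2) ^ k *
  X ((2 * p + q) * Z.of_nat k)%Z / Binomial.C (3 * k) k.

End Consts.

(* Main.v *)
Require Import Defs.
From Stdlib Require Import Reals ZArith Lra Lia.
From Coquelicot Require Import Coquelicot.
Open Scope R_scope.

(** Put [S(x) = sum_(k>=1) x^k / C(3k,k)].  Binet's formula and the identities
    [F_(p+q) - s^q F_p = t^p F_q], [{s,t} = {alpha,beta}], turn the two series into
    combinations of [S(x_alpha)] and [S(x_beta)] with
    [x_s = -27 A w / (A - w)^2], [A = F_(p+q)], [w = s^q F_p].
    The Beta integral gives [2 int_0^1 (1+3u) (u^2(1-u))^k du = 27 a_(k+1) - 4 a_k] for
    [a_k = 1/C(3k,k)], so [S(x)] is an affine function of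
    [int_0^1 (1+3u) / (1 - x u^2(1-u)) du].  For [x = -27 d^3/(1-d^3)^2] the cubic in the
    denominator has a root that is rational in [d], and the integral is elementary with
    coefficients rational in [d].  Here [d] is the ratio, smaller than 1 in absolute value,
    of the real cube roots of [A] and [w]: the larger one is [w] for [s = alpha] and [A] for
    [s = beta]. *)

(** * Beta integrals and reciprocals of [C(3k,k)] *)

(** Induction on [n] by integration by parts: trading one factor [1 - s] for a factor [s] costs the
    ratio [(n+1)/(m+1)]. The exponent [m] grows in the process, so it stays general. *)
Lemma is_RInt_beta (m n : nat) :
  is_RInt (fun s => s ^ m * (1 - s) ^ n) 0 1
    (INR (fact m) * INR (fact n) / INR (fact (m + n + 1))).
Proof.
  revert m; induction n as [|n IH]; intros m.
  - replace (INR (fact m) * INR (fact 0) / INR (fact (m + 0 + 1)))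
      with (minus (/ INR (S m) * 1 ^ S m) (/ INR (S m) * 0 ^ S m)).
    + apply (is_RInt_derive (fun s => / INR (S m) * s ^ S m)).
      * intros s _. auto_derive; [trivial|].
        change (match m with O => 1 | S _ => INR m + 1 end) with (INR (S m)).
        field. apply not_0_INR; lia.
      * intros s _. apply (ex_derive_continuous (fun s => s ^ m * (1 - s) ^ 0)).
        auto_derive; trivial.
    + replace (m + 0 + 1)%nat with (S m) by lia.
      rewrite fact_simpl, mult_INR. change (fact 0) with 1%nat.
      unfold minus, plus, opp; simpl (0 ^ _); rewrite pow1. cbn -[INR fact].
      change (INR 1) with 1.
      field. split; [apply INR_fact_neq_0|apply not_0_INR; lia].
  (* The integrand is the derivative of [s ^ S m * (1 - s) ^ S n], which vanishes at both
     endpoints. *)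
  - assert (H0 : is_RInt (fun s => INR (S m) * (s ^ m * (1 - s) ^ S n)
                   - INR (S n) * (s ^ S m * (1 - s) ^ n)) 0 1 0).
    { replace 0 with (minus (1 ^ S m * (1 - 1) ^ S n) (0 ^ S m * (1 - 0) ^ S n)) at 2.
      - apply (is_RInt_derive (fun s => s ^ S m * (1 - s) ^ S n)).
        + intros s _. auto_derive; [trivial|].
          change (match m with O => 1 | S _ => INR m + 1 end) with (INR (S m)).
          change (match n with O => 1 | S _ => INR n + 1 end) with (INR (S n)).
          change (1 + - s) with (1 - s). simpl pow. ring.
        + intros s _.
          apply (ex_derive_continuous (fun s => INR (S m) * (s ^ m * (1 - s) ^ S n)
                   - INR (S n) * (s ^ S m * (1 - s) ^ n))). auto_derive; trivial.
      - unfold minus, plus, opp; simpl. ring. }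
    specialize (IH (S m)).
    pose proof (is_RInt_plus _ _ _ _ _ _ H0 (is_RInt_scal _ _ _ (INR (S n)) _ IH)) as H1.
    apply (is_RInt_scal _ _ _ (/ INR (S m))) in H1.
    assert (hm : INR (S m) <> 0) by (apply not_0_INR; lia).
    replace (INR (fact m) * INR (fact (S n)) / INR (fact (m + S n + 1))) with
      (/ INR (S m) * (0 + INR (S n) *
        (INR (fact (S m)) * INR (fact n) / INR (fact (S m + n + 1))))).
    + eapply is_RInt_ext; [|exact H1]. intros s _.
      change (/ INR (S m) * (INR (S m) * (s ^ m * (1 - s) ^ S n)
        - INR (S n) * (s ^ S m * (1 - s) ^ n)
        + INR (S n) * (s ^ S m * (1 - s) ^ n)) = s ^ m * (1 - s) ^ S n).
      field. exact hm.
    + replace (m + S n + 1)%nat with (S m + n + 1)%nat by lia.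
      rewrite (fact_simpl m), (fact_simpl n), !mult_INR.
      field. split; [apply INR_fact_neq_0|exact hm].
Qed.

Definition icb (k : nat) : R := / Binomial.C (3 * k) k.

Lemma icb_fact (k : nat) :
  icb k = INR (fact k) * INR (fact (2 * k)) / INR (fact (3 * k)).
Proof.
  unfold icb, Binomial.C. replace (3 * k - k)%nat with (2 * k)%nat by lia.
  field. repeat split; apply INR_fact_neq_0.
Qed.

Lemma icb_pos (k : nat) : 0 < icb k.
Proof.
  rewrite icb_fact. apply Rdiv_lt_0_compat; [apply Rmult_lt_0_compat|]; apply INR_fact_lt_0.
Qed.

Lemma icb_S (k : nat) :
  icb (S k) = icb k * (2 * (INR k + 1) * (2 * INR k + 1)
                / (3 * (3 * INR k + 1) * (3 * INR k + 2))).
Proof.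
  rewrite !icb_fact.
  replace (2 * S k)%nat with (S (S (2 * k))) by lia.
  replace (3 * S k)%nat with (S (S (S (3 * k)))) by lia.
  rewrite !fact_simpl, !mult_INR, !S_INR, !mult_INR.
  pose proof (pos_INR k). simpl (INR 2). simpl (INR 3).
  field. repeat split; try apply INR_fact_neq_0; lra.
Qed.

(** The ratio [icb (S k) / icb k] tends to [4/27], so the quadratic terms cancel and the right side
    is [icb k] times [(9k+5)/((3k+1)(3k+2))]. The two Beta values contribute [3k+2] and [2k+1] over
    the same denominator, and [9k+5 = (3k+2) + 3(2k+1)] dictates the weight [1 + 3 s]. *)
Lemma is_RInt_kernel_pow (k : nat) :
  is_RInt (fun s => (1 + 3 * s) * (s ^ 2 * (1 - s)) ^ k) 0 1
    ((27 * icb (S k) - 4 * icb k) / 2).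
Proof.
  pose proof (is_RInt_plus _ _ _ _ _ _ (is_RInt_beta (2 * k) k)
    (is_RInt_scal _ _ _ 3 _ (is_RInt_beta (S (2 * k)) k))) as H.
  replace ((27 * icb (S k) - 4 * icb k) / 2) with
    (INR (fact (2 * k)) * INR (fact k) / INR (fact (2 * k + k + 1))
     + 3 * (INR (fact (S (2 * k))) * INR (fact k) / INR (fact (S (2 * k) + k + 1)))).
  - eapply is_RInt_ext; [|exact H]. intros s _.
    change (s ^ (2 * k) * (1 - s) ^ k + 3 * (s ^ S (2 * k) * (1 - s) ^ k) =
      (1 + 3 * s) * (s ^ 2 * (1 - s)) ^ k).
    rewrite Rpow_mult_distr, <- pow_mult. rewrite <- tech_pow_Rmult. ring.
  - rewrite icb_S, icb_fact.
    replace (2 * k + k + 1)%nat with (S (3 * k)) by lia.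
    replace (S (2 * k) + k + 1)%nat with (S (S (3 * k))) by lia.
    rewrite !fact_simpl, !mult_INR, !S_INR, !mult_INR.
    pose proof (pos_INR k). simpl (INR 2). simpl (INR 3).
    field. repeat split; try apply INR_fact_neq_0; lra.
Qed.

(** The factor [3k+1] is chosen so that the bound grows by [(4/27)(3k+4)/(3k+1)] at each step, which
    dominates the ratio given by [icb_S]. *)
Lemma icb_le (k : nat) : icb k <= (3 * INR k + 1) * (4 / 27) ^ k.
Proof.
  induction k as [|k IH].
  - rewrite icb_fact. simpl. lra.
  - rewrite icb_S. pose proof (pos_INR k) as hk. pose proof (icb_pos k).
    assert (hp : 0 < (4 / 27) ^ k) by (apply pow_lt; lra).
    apply Rle_trans with (((3 * INR k + 1) * (4 / 27) ^ k) *
      ((3 * INR k + 4) * 4 / (27 * (3 * INR k + 1)))).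
    + apply Rmult_le_compat; [lra| |exact IH|].
      * apply Rlt_le, Rdiv_lt_0_compat; nra.
      * apply Rminus_le.
        replace (2 * (INR k + 1) * (2 * INR k + 1) / (3 * (3 * INR k + 1) * (3 * INR k + 2))
          - (3 * INR k + 4) * 4 / (27 * (3 * INR k + 1))) with
          (- ((18 * INR k + 14) / (27 * (3 * INR k + 1) * (3 * INR k + 2)))).
        -- assert (0 < (18 * INR k + 14) / (27 * (3 * INR k + 1) * (3 * INR k + 2)));
             [apply Rdiv_lt_0_compat; nra|lra].
        -- field. lra.
    + rewrite S_INR. simpl pow. right. field. lra.
Qed.

(** * Convergence and term-by-term integration *)

(** With [r = t * t] and [/ t = 1 + h], Bernoulli's inequality bounds [n t^n] by [/ h]; the other
    factor [t^n] still tends to 0. *)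
Lemma is_lim_seq_affine_geom (r : R) :
  0 <= r < 1 -> is_lim_seq (fun n => (3 * INR n + 1) * r ^ n) 0.
Proof.
  intros [h0 h1].
  destruct (Req_dec r 0) as [->|hr].
  (* At [n = 0] the term is 1, so agreement with the zero sequence starts at index 1. *)
  { apply is_lim_seq_ext_loc with (fun _ => 0); [|apply is_lim_seq_const].
    exists 1%nat. intros [|n] hn; [lia|]. simpl. ring. }
  set (t := sqrt r).
  assert (ht : 0 < t) by (apply sqrt_lt_R0; lra).
  assert (ht2 : t * t = r) by (apply sqrt_sqrt; lra).
  assert (ht1 : t < 1) by nra.
  set (h := / t - 1).
  assert (hh : 0 < h). { unfold h. pose proof (Rinv_lt_contravar t 1 ltac:(lra) ht1). lra. }
  apply is_lim_seq_le_le with (fun _ => 0) (fun n => (3 / h + 1) * t ^ n).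
  - intros n. split.
    + apply Rmult_le_pos; [pose proof (pos_INR n); lra|apply pow_le; lra].
    + rewrite <- ht2, Rpow_mult_distr, <- Rmult_assoc.
      apply Rmult_le_compat_r; [apply pow_le; lra|].
      pose proof (poly n h hh) as hb.
      assert (he : (1 + h) ^ n * t ^ n = 1).
      { rewrite <- Rpow_mult_distr. replace ((1 + h) * t) with 1; [apply pow1|].
        unfold h. field. lra. }
      assert (hp : 0 < t ^ n) by (apply pow_lt; lra).
      assert (hp1 : t ^ n <= 1) by (rewrite <- (pow1 n); apply pow_incr; lra).
      assert (INR n * t ^ n <= / h).
      { apply Rmult_le_reg_r with h; [exact hh|]. rewrite Rinv_l by lra. nra. }
      unfold Rdiv. lra.
  - apply is_lim_seq_const.
  - evar_last. apply is_lim_seq_scal_l. apply is_lim_seq_geom. rewrite Rabs_pos_eq; lra.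
    simpl. f_equal. ring.
Qed.

(** The partial sums integrate a truncated geometric series in [x * w], [w = s^2 (1-s)]. Its
    explicit remainder is at most [4 r^(n+1) / (1-r)] on the whole of [[0,1]], which justifies
    exchanging sum and integral. *)
Lemma is_series_kernel (x J : R) :
  Rabs x < 27 / 4 ->
  is_RInt (fun s => (1 + 3 * s) / (1 - x * (s ^ 2 * (1 - s)))) 0 1 J ->
  is_series (fun k => x ^ k * ((27 * icb (S k) - 4 * icb k) / 2)) J.
Proof.
  intros hx hJ.
  set (r := Rabs x * (4 / 27)).
  assert (hr0 : 0 <= r) by (pose proof (Rabs_pos x); unfold r; lra).
  assert (hr1 : r < 1) by (unfold r; lra).
  assert (hn : forall n, is_RInt (fun s => sum_n (fun k => x ^ k *
             ((1 + 3 * s) * (s ^ 2 * (1 - s)) ^ k)) n) 0 1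
             (sum_n (fun k => x ^ k * ((27 * icb (S k) - 4 * icb k) / 2)) n)).
  { induction n as [|n IH].
    - rewrite sum_O. eapply is_RInt_ext.
      2: apply (is_RInt_scal _ _ _ (x ^ 0) _ (is_RInt_kernel_pow 0)).
      intros s _. simpl. rewrite sum_O. reflexivity.
    - rewrite sum_Sn. eapply is_RInt_ext.
      2: apply (is_RInt_plus _ _ _ _ _ _ IH
           (is_RInt_scal _ _ _ (x ^ S n) _ (is_RInt_kernel_pow (S n)))).
      intros s _. simpl. rewrite sum_Sn. reflexivity. }
  apply (is_lim_seq_ext (fun n => J -
     (J - sum_n (fun k => x ^ k * ((27 * icb (S k) - 4 * icb k) / 2)) n))
     _ (Finite J)); [intros n; simpl|].
  { match goal with |- _ = ?t => change (J - (J - t) = t :> R) end. ring. }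
  evar_last.
  apply is_lim_seq_minus'; [apply is_lim_seq_const|].
  apply is_lim_seq_abs_0.
  apply is_lim_seq_le_le with (fun _ => 0) (fun n => (4 * r / (1 - r)) * r ^ n).
  2: apply is_lim_seq_const.
  2: { evar_last. apply is_lim_seq_scal_l. apply is_lim_seq_geom.
       rewrite Rabs_pos_eq; lra. simpl. f_equal. ring. }
  2: { f_equal. ring. }
  intros n. split; [apply Rabs_pos|].
  assert (hd := is_RInt_minus _ _ _ _ _ _ hJ (hn n)).
  replace (4 * r / (1 - r) * r ^ n) with ((1 - 0) * (4 * r ^ S n / (1 - r)))
    by (simpl; field; lra).
  refine (norm_RInt_le_const _ 0 1 _ _ Rle_0_1 _ hd).
  intros s hs.
  set (w := s ^ 2 * (1 - s)).
  assert (hw0 : 0 <= w). { unfold w. apply Rmult_le_pos; [apply pow2_ge_0|lra]. }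
  (* The maximum is at [s = 2/3]: the gap [4/27 - w] equals [(s - 2/3)^2 (s + 1/3)]. *)
  assert (hw1 : w <= 4 / 27).
  { assert (0 <= (s - 2 / 3) ^ 2 * (s + 1 / 3))
      by (apply Rmult_le_pos; [apply pow2_ge_0|lra]). unfold w. nra. }
  assert (hy : Rabs (x * w) <= r).
  { rewrite Rabs_mult, (Rabs_pos_eq w) by exact hw0. unfold r.
    apply Rmult_le_compat_l; [apply Rabs_pos|exact hw1]. }
  assert (hy' : 1 - x * w >= 1 - r) by (pose proof (Rle_abs (x * w)); lra).
  assert (hs' : sum_n (fun k => x ^ k * ((1 + 3 * s) * w ^ k)) n
     = (1 + 3 * s) / (1 - x * w) - (1 + 3 * s) * (x * w) ^ S n / (1 - x * w)).
  { assert (H : 1 - x * w <> 0) by lra. clear - H. induction n as [|n IH].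
    - rewrite sum_O. simpl. field. exact H.
    - rewrite sum_Sn, IH. rewrite !Rpow_mult_distr. unfold plus; simpl. field. exact H. }
  rewrite hs'.
  match goal with |- norm ?t <= _ => change (norm t) with (Rabs t);
    replace t with ((1 + 3 * s) * (x * w) ^ S n / (1 - x * w)) end.
  - unfold Rdiv. rewrite !Rabs_mult, (Rabs_pos_eq (1 + 3 * s)) by lra.
    rewrite Rabs_inv, (Rabs_pos_eq (1 - x * w)) by lra.
    rewrite <- RPow_abs.
    apply Rmult_le_compat.
    + apply Rmult_le_pos; [lra|apply pow_le, Rabs_pos].
    + apply Rlt_le, Rinv_0_lt_compat; lra.
    + apply Rmult_le_compat; [lra|apply pow_le, Rabs_pos|lra|].
      apply pow_incr. split; [apply Rabs_pos|exact hy].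
    + apply Rinv_le_contravar; lra.
  - unfold minus, plus, opp; simpl. fold w. ring.
Qed.

(** Shifting the index in [27 icb (S k) - 4 icb k] gives a linear equation for the sum; the constant
    [4 x] comes from [icb 0 = 1], which the sum omits. *)
Lemma is_series_icb (x J : R) :
  Rabs x < 27 / 4 ->
  is_RInt (fun s => (1 + 3 * s) / (1 - x * (s ^ 2 * (1 - s)))) 0 1 J ->
  is_series (fun k => x ^ S k * icb (S k)) ((2 * x * J + 4 * x) / (27 - 4 * x)).
Proof.
  intros hx hJ.
  assert (hx' : 27 - 4 * x <> 0) by (pose proof (Rle_abs x); lra).
  pose proof (is_series_kernel x J hx hJ) as hs.
  set (c := fun k => x ^ k * ((27 * icb (S k) - 4 * icb k) / 2)) in hs.
  (* The linear equation for partial sums, with a boundary term that [ht] sends to 0. Nothing is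
     divided by [x], so [x = 0] needs no separate case. *)
  assert (hsum : forall n, sum_n (fun k => x ^ S k * icb (S k)) n =
     (2 * x * sum_n c n + 4 * x - 4 * x * (x ^ S n * icb (S n))) / (27 - 4 * x)).
  { induction n as [|n IH].
    - rewrite !sum_O. unfold c.
      match goal with |- @eq _ ?a ?b => change (@eq R a b) end.
      replace (icb 0) with 1; [field; exact hx'|].
      rewrite icb_fact. simpl. field.
    - rewrite !sum_Sn, IH. unfold c, plus; simpl.
      match goal with |- @eq _ ?a ?b => change (@eq R a b) end. field. exact hx'. }
  assert (ht : is_lim_seq (fun n => x ^ n * icb n) 0).
  { set (r := Rabs x * (4 / 27)).
    assert (hr0 : 0 <= r) by (pose proof (Rabs_pos x); unfold r; lra).
    assert (hr1 : r < 1) by (unfold r; lra).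
    apply is_lim_seq_abs_0.
    apply is_lim_seq_le_le with (fun _ => 0) (fun n => (3 * INR n + 1) * r ^ n);
      [|apply is_lim_seq_const|apply is_lim_seq_affine_geom; lra].
    intros n; split; [apply Rabs_pos|].
    rewrite Rabs_mult, <- RPow_abs, (Rabs_pos_eq (icb n)) by (apply Rlt_le, icb_pos).
    unfold r. rewrite Rpow_mult_distr.
    pose proof (icb_le n). pose proof (pow_le (Rabs x) n (Rabs_pos x)). nra. }
  apply (is_lim_seq_ext (fun n =>
     (2 * x * sum_n c n + 4 * x - 4 * x * (x ^ S n * icb (S n))) * / (27 - 4 * x)) _
     (Finite ((2 * x * J + 4 * x) / (27 - 4 * x)))).
  { intros n. symmetry. apply hsum. }
  replace ((2 * x * J + 4 * x) / (27 - 4 * x)) with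
    ((2 * x * J + 4 * x - 4 * x * 0) * / (27 - 4 * x)) by (field; exact hx').
  apply is_lim_seq_mult'; [|apply is_lim_seq_const].
  apply is_lim_seq_minus'; [apply is_lim_seq_plus'|]; try apply is_lim_seq_const;
    apply is_lim_seq_mult'; try apply is_lim_seq_const.
  - exact hs.
  - apply (is_lim_seq_incr_1 (fun n => x ^ n * icb n)). exact ht.
Qed.

(** * Elementary evaluation of the integral *)

Lemma is_derive_atan_comp (u : R -> R) (t du : R) :
  is_derive u t du -> is_derive (fun y => atan (u y)) t (du / (1 + u t ^ 2)).
Proof.
  intros hu. evar_last.
  - apply (is_derive_comp atan u); [apply is_derive_atan|exact hu].
  - unfold scal; simpl; unfold mult; simpl. unfold Rdiv, Rsqr. rewrite Rmult_1_r. reflexivity.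
Qed.

(** Both sides have derivative [3 sqrt 3 / (2 (1+d+d^2))] and vanish at [d = 0]; comparing
    derivatives avoids any discussion of branches of the arctangent. *)
Lemma atan_triple (d : R) : -1 < d < 1 ->
  atan ((1 + 4 * d + d ^ 2) / (sqrt 3 * (1 - d ^ 2)))
  - atan ((1 - d) ^ 2 / (sqrt 3 * (1 - d ^ 2)))
  = 3 * atan (sqrt 3 * d / (2 + d)).
Proof.
  intros hd.
  set (r := sqrt 3).
  assert (hr : r * r = 3) by (apply sqrt_sqrt; lra).
  assert (hr0 : 0 < r) by (apply sqrt_lt_R0; lra).
  set (f := fun d => atan ((1 + 4 * d + d ^ 2) / (r * (1 - d ^ 2)))
    - atan ((1 - d) ^ 2 / (r * (1 - d ^ 2))) - 3 * atan (r * d / (2 + d))).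
  assert (hf : forall t, -1 < t < 1 -> is_derive f t 0).
  { intros t ht. unfold f.
    assert (h1 : 0 < 1 - t ^ 2) by nra.
    assert (h2 : 0 < 1 + t + t ^ 2) by nra.
    assert (hr2 : r ^ 2 = 3) by (simpl; lra).
    evar_last.
    { apply (is_derive_minus (fun d => atan ((1 + 4 * d + d ^ 2) / (r * (1 - d ^ 2)))
        - atan ((1 - d) ^ 2 / (r * (1 - d ^ 2)))) (fun d => 3 * atan (r * d / (2 + d)))).
      - apply (is_derive_minus (fun d => atan ((1 + 4 * d + d ^ 2) / (r * (1 - d ^ 2))))
         (fun d => atan ((1 - d) ^ 2 / (r * (1 - d ^ 2))))).
        + apply (is_derive_atan_comp _ _ (4 * (1 + t + t ^ 2) / (r * (1 - t ^ 2) ^ 2))).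
          auto_derive; [nra|simpl; field; nra].
        + apply (is_derive_atan_comp _ _ (- 2 / (r * (1 + t) ^ 2))).
          auto_derive; [nra|simpl; field; nra].
      - apply is_derive_scal.
        apply (is_derive_atan_comp _ _ (2 * r / (2 + t) ^ 2)).
        auto_derive; [lra|simpl; field; lra]. }
    cbv beta.
    replace (1 + ((1 + 4 * t + t ^ 2) / (r * (1 - t ^ 2))) ^ 2) with
         (4 * (1 + t + t ^ 2) ^ 2 / (3 * (1 - t ^ 2) ^ 2)).
    2: { unfold Rdiv. rewrite !Rpow_mult_distr, pow_inv, Rpow_mult_distr, hr2. field. lra. }
    replace (1 + ((1 - t) ^ 2 / (r * (1 - t ^ 2))) ^ 2) with
         (4 * (1 + t + t ^ 2) / (3 * (1 + t) ^ 2)).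
    2: { unfold Rdiv. rewrite !Rpow_mult_distr, pow_inv, Rpow_mult_distr, hr2. field. nra. }
    replace (1 + (r * t / (2 + t)) ^ 2) with (4 * (1 + t + t ^ 2) / (2 + t) ^ 2).
    2: { unfold Rdiv. rewrite !Rpow_mult_distr, hr2. field. lra. }
    unfold minus, plus, opp, scal; simpl; unfold mult; simpl.
    replace (2 * r) with (2 * 3 / r) by (rewrite <- hr; field; lra).
    field. repeat split; nra. }
  assert (h0 : f 0 = 0).
  { unfold f. replace (r * 0 / (2 + 0)) with 0 by field. rewrite atan_0.
    replace ((1 + 4 * 0 + 0 ^ 2) / (r * (1 - 0 ^ 2))) with (/ r) by (field; lra).
    replace ((1 - 0) ^ 2 / (r * (1 - 0 ^ 2))) with (/ r) by (field; lra). ring. }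
  assert (h : f d = 0).
  { destruct (MVT_gen f 0 d (fun _ => 0)) as (c & _ & hc).
    - intros t ht. apply hf. revert ht. unfold Rmin, Rmax. destruct (Rle_dec 0 d); lra.
    - intros t ht. apply continuity_pt_filterlim.
      apply (ex_derive_continuous f). exists 0. apply hf.
      revert ht. unfold Rmin, Rmax. destruct (Rle_dec 0 d); lra.
    - lra. }
  unfold f in h. lra.
Qed.

(** Up to the constant [4 (1-d^3)^2], the cubic denominator splits as [L s * Q s]: [L] carries the
    rational root [(1+d+d^2)/(3d)] and [Q] is a sum of squares without real root. Partial fractions
    then give the antiderivative [Phi]. *)
Lemma is_RInt_kernel (d : R) : -1 < d < 1 -> d <> 0 ->
  is_RInt (fun s => (1 + 3 * s) /
             (1 - - 27 * d ^ 3 / (1 - d ^ 3) ^ 2 * (s ^ 2 * (1 - s)))) 0 1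
    ((1 - d ^ 3) / (6 * d ^ 2 * (1 + d ^ 3)) *
      ((1 - d) * (1 + d) ^ 3 * ln ((1 + d + d ^ 2) / (1 - d) ^ 2)
       - 2 * sqrt 3 * (1 - 2 * d - 2 * d ^ 3 + d ^ 4) * atan (sqrt 3 * d / (2 + d)))).
Proof.
  intros hd hd0.
  set (r := sqrt 3).
  assert (hr : r * r = 3) by (apply sqrt_sqrt; lra).
  assert (hr0 : 0 < r) by (apply sqrt_lt_R0; lra).
  assert (h1 : 0 < 1 - d) by lra.
  assert (h2 : 0 < 1 + d + d ^ 2) by nra.
  assert (h3 : 0 < 1 - d + d ^ 2) by nra.
  assert (h4 : 0 < 1 - d ^ 3)
    by (replace (1 - d ^ 3) with ((1 - d) * (1 + d + d ^ 2)) by ring; nra).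
  assert (h5 : 0 < 1 + d ^ 3)
    by (replace (1 + d ^ 3) with ((1 + d) * (1 - d + d ^ 2)) by ring; nra).
  assert (h6 : 0 < 1 - d ^ 2) by nra.
  (* Partial fraction coefficients. In [Phi] the logarithms of [L] and [Q] carry [- a] and [a / 2]
     because the integrand decays like [1/s^2] at infinity, so the [1/s] terms cancel. *)
  set (a := (1 + d) ^ 3 * (1 - d) * (1 - d ^ 3) / (9 * d ^ 2 * (1 + d ^ 3))).
  set (k := - r / 9 * (1 - 2 * d - 2 * d ^ 3 + d ^ 4) * (1 - d ^ 3) / (d ^ 2 * (1 + d ^ 3))).
  set (L := fun s => 1 + d + d ^ 2 - 3 * d * s).
  set (m := fun s => 6 * d * s + (1 - d) ^ 2).
  set (Q := fun s => m s ^ 2 + 3 * (1 - d ^ 2) ^ 2).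
  (* [L] is affine with positive end values [1+d+d^2] and [(1-d)^2]. *)
  assert (hL : forall s, 0 <= s <= 1 -> 0 < L s).
  { intros s hs. unfold L. destruct (Rle_dec 0 d); nra. }
  assert (hQ : forall s, 0 < Q s).
  { intros s. unfold Q. pose proof (pow2_ge_0 (m s)). pose proof (pow_lt _ 2 h6). lra. }
  assert (hD : forall s, 1 - - 27 * d ^ 3 / (1 - d ^ 3) ^ 2 * (s ^ 2 * (1 - s)) =
     L s * Q s / (4 * (1 - d ^ 3) ^ 2)).
  { intros s. unfold L, Q, m. field. lra. }
  set (Phi := fun s => - a * ln (L s) + a / 2 * ln (Q s)
                + k * atan (m s / (r * (1 - d ^ 2)))).
  match goal with |- is_RInt _ _ _ ?v => replace v with (minus (Phi 1) (Phi 0)) end.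
  - apply (is_RInt_derive Phi).
    + rewrite Rmin_left, Rmax_right by lra. intros s hs.
      specialize (hL s hs). specialize (hQ s). rewrite hD.
      assert (hat : 1 + (m s / (r * (1 - d ^ 2))) ^ 2 = Q s / (3 * (1 - d ^ 2) ^ 2)).
      { unfold Q. replace 3 with (r * r) at 1 2. field. lra. }
      evar_last. unfold Phi.
      apply (is_derive_plus (fun s => - a * ln (L s) + a / 2 * ln (Q s))
                 (fun s => k * atan (m s / (r * (1 - d ^ 2))))).
      * instantiate (1 := - a * (- 3 * d / L s) + a / 2 * (12 * d * m s / Q s)).
        unfold Q, L, m in *. auto_derive.
        -- repeat split; simpl in *; lra.
        -- simpl. field. simpl in *; lra.
      * apply is_derive_scal.
        apply (is_derive_atan_comp _ _ (6 * d / (r * (1 - d ^ 2)))).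
        unfold m. auto_derive; [trivial|]. simpl. field. simpl in *; lra.
      * cbv beta. rewrite hat.
        change (- a * (-3 * d / L s) + a / 2 * (12 * d * m s / Q s)
          + k * (6 * d / (r * (1 - d ^ 2)) / (Q s / (3 * (1 - d ^ 2) ^ 2)))
          = (1 + 3 * s) / (L s * Q s / (4 * (1 - d ^ 3) ^ 2))).
        unfold k, a, Q, L, m in *.
        field. repeat split; simpl in *; lra.
    + rewrite Rmin_left, Rmax_right by lra. intros s hs.
      apply (ex_derive_continuous (fun s => (1 + 3 * s) /
             (1 - - 27 * d ^ 3 / (1 - d ^ 3) ^ 2 * (s ^ 2 * (1 - s))))).
      auto_derive.
      change (1 - - 27 * d ^ 3 / (1 - d ^ 3) ^ 2 * (s ^ 2 * (1 - s)) <> 0).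
      rewrite hD. apply Rgt_not_eq, Rdiv_lt_0_compat.
      * apply Rmult_lt_0_compat; auto.
      * pose proof (pow_lt _ 2 h4). lra.
  - unfold Phi.
    replace (L 1) with ((1 - d) ^ 2) by (unfold L; ring).
    replace (L 0) with (1 + d + d ^ 2) by (unfold L; ring).
    replace (Q 1) with (4 * (1 + d + d ^ 2) ^ 2) by (unfold Q, m; ring).
    replace (Q 0) with (4 * ((1 - d) ^ 2 * (1 + d + d ^ 2))) by (unfold Q, m; ring).
    replace (m 1) with (1 + 4 * d + d ^ 2) by (unfold m; ring).
    replace (m 0) with ((1 - d) ^ 2) by (unfold m; ring).
    pose proof (pow_lt _ 2 h1) as h1'. pose proof (pow_lt _ 2 h2) as h2'.
    rewrite ln_div by lra.
    rewrite !(ln_mult 4), (ln_mult ((1 - d) ^ 2)) by (try apply Rmult_lt_0_compat; lra).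
    replace ((1 + d + d ^ 2) ^ 2) with ((1 + d + d ^ 2) * (1 + d + d ^ 2)) by ring.
    rewrite (ln_mult (1 + d + d ^ 2)) by lra.
    (* The endpoint values of [m] are exactly the numerators in [atan_triple], so the two
       arctangents of [Phi] merge into one. *)
    replace (atan (r * d / (2 + d))) with
      ((atan ((1 + 4 * d + d ^ 2) / (r * (1 - d ^ 2)))
        - atan ((1 - d) ^ 2 / (r * (1 - d ^ 2)))) / 3)
      by (unfold r; rewrite atan_triple by exact hd; field).
    unfold minus, plus, opp; simpl plus; unfold k, a.
    match goal with |- @eq _ ?a ?b => change (@eq R a b) end.
    simpl. field. simpl in *; lra.
Qed.

(** * The closed form in homogeneous variables *)

(* Homogeneous form of: the ratio [e = y/w] satisfies [0 < |e| < 1] and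
   [|-27 e / (1-e)^2| < 27/4], the disc of convergence. *)
Definition separated (y w : R) : Prop :=
  y <> 0 /\ Rabs y < Rabs w /\ 4 * Rabs (y * w) < (w - y) ^ 2.

Lemma separated_scal (c y w : R) : c <> 0 -> separated y w -> separated (c * y) (c * w).
Proof.
  intros hc (h1 & h2 & h3). assert (hc' : 0 < Rabs c) by (apply Rabs_pos_lt; exact hc).
  repeat split.
  - apply Rmult_integral_contrapositive; auto.
  - rewrite !Rabs_mult. apply Rmult_lt_compat_l; auto.
  - replace (c * y * (c * w)) with (c * c * (y * w)) by ring.
    replace ((c * w - c * y) ^ 2) with (c * c * (w - y) ^ 2) by ring.
    rewrite Rabs_mult, (Rabs_pos_eq (c * c)) by nra.
    rewrite <- Rmult_assoc, (Rmult_comm 4), Rmult_assoc. apply Rmult_lt_compat_l; nra.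
Qed.

(* The closed form of [S(x)] at [d = a/b], written homogeneously in [a] and [b]. *)
Definition icb_sum (a b : R) : R :=
  - 4 * a ^ 3 * b ^ 3 / (a ^ 3 + b ^ 3) ^ 2
  - a * b * (b ^ 3 - a ^ 3) / (3 * (a ^ 3 + b ^ 3) ^ 3) *
    ((b - a) * (b + a) ^ 3 * ln ((b ^ 3 - a ^ 3) / (b - a) ^ 3)
     - 2 * sqrt 3 * (b ^ 4 - 2 * a * b ^ 3 - 2 * a ^ 3 * b + a ^ 4)
         * atan (sqrt 3 * a / (2 * b + a))).

(** Supplies the nonvanishing denominators of [icb_sum]. Cubing preserves the order of absolute
    values, so [|a| < |b|], and no sum or difference of the two can vanish. *)
Lemma separated_cube (a b : R) : separated (a ^ 3) (b ^ 3) ->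
  a <> 0 /\ b <> 0 /\ b - a <> 0 /\ 2 * b + a <> 0 /\ a ^ 3 + b ^ 3 <> 0 /\ b ^ 3 - a ^ 3 <> 0
  /\ -1 < a / b < 1.
Proof.
  intros (h1 & h2 & h3).
  assert (ha : a <> 0) by (intros ->; apply h1; ring).
  assert (hb : b <> 0).
  { intros ->. replace (0 ^ 3) with 0 in h2 by ring. rewrite Rabs_R0 in h2.
    pose proof (Rabs_pos (a ^ 3)). lra. }
  assert (hab : Rabs a < Rabs b).
  { apply Rnot_le_lt. intros h. apply (Rlt_not_le _ _ h2). rewrite <- !RPow_abs.
    apply pow_incr. split; [apply Rabs_pos|exact h]. }
  assert (hne : forall s t, Rabs s < Rabs t -> t + s <> 0 /\ t - s <> 0 /\ 2 * t + s <> 0).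
  { intros s t. unfold Rabs. destruct (Rcase_abs s), (Rcase_abs t); intros; repeat split; lra. }
  destruct (hne _ _ hab) as (_ & h5 & h6). destruct (hne _ _ h2) as (h7 & h8 & _).
  repeat split; auto; try lra.
  all: apply (Rabs_def2 (a / b) 1); unfold Rdiv; rewrite Rabs_mult, Rabs_inv;
    apply Rmult_lt_reg_r with (Rabs b); [apply Rabs_pos_lt; exact hb|];
    rewrite Rmult_assoc, Rinv_l, Rmult_1_r, Rmult_1_l;
    [exact hab|apply Rabs_no_R0; exact hb].
Qed.

Lemma is_series_icb_sum (a b : R) : separated (a ^ 3) (b ^ 3) ->
  is_series (fun n => (- 27 * (a ^ 3 * b ^ 3) / (b ^ 3 - a ^ 3) ^ 2) ^ S n * icb (S n))
    (icb_sum a b).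
Proof.
  intros hs. destruct (separated_cube a b hs) as (ha & hb & h1 & h2 & h3 & h4 & hd).
  destruct hs as (_ & _ & hs).
  set (d := a / b) in *.
  assert (hab : a = d * b) by (unfold d; field; exact hb).
  assert (hd0 : d <> 0) by (intros h; apply ha; rewrite hab, h; ring).
  assert (hd3 : 1 - d ^ 3 <> 0).
  { intros h. apply h4. rewrite hab. transitivity (b ^ 3 * (1 - d ^ 3)); [ring|rewrite h; ring]. }
  assert (hd3' : 1 + d ^ 3 <> 0).
  { intros h. apply h3. rewrite hab. transitivity (b ^ 3 * (1 + d ^ 3)); [ring|rewrite h; ring]. }
  assert (hx : - 27 * (a ^ 3 * b ^ 3) / (b ^ 3 - a ^ 3) ^ 2 = - 27 * d ^ 3 / (1 - d ^ 3) ^ 2).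
  { rewrite hab. field. repeat split; auto.
    intros h; apply h4; rewrite hab; rewrite <- h; ring. }
  rewrite hx.
  (* This is the third clause of [separated], divided by [(b^3 - a^3)^2]. *)
  assert (hxb : Rabs (- 27 * d ^ 3 / (1 - d ^ 3) ^ 2) < 27 / 4).
  { rewrite <- hx.
    assert (hq : 0 < (b ^ 3 - a ^ 3) ^ 2) by (apply pow2_gt_0; exact h4).
    unfold Rdiv. rewrite !Rabs_mult, Rabs_inv, (Rabs_pos_eq ((_ - _) ^ 2)) by lra.
    rewrite Rabs_mult in hs. replace (Rabs (-27)) with 27 by (rewrite Rabs_left; lra).
    apply Rmult_lt_reg_r with ((b ^ 3 - a ^ 3) ^ 2); [exact hq|].
    rewrite Rmult_assoc, Rinv_l by lra. lra. }
  evar_last. apply (is_series_icb _ _ hxb (is_RInt_kernel d hd hd0)).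
  unfold icb_sum.
  replace (sqrt 3 * a / (2 * b + a)) with (sqrt 3 * d / (2 + d)).
  2: { rewrite hab. field. split; [|lra]. rewrite <- hab. exact h2. }
  replace ((b ^ 3 - a ^ 3) / (b - a) ^ 3) with ((1 + d + d ^ 2) / (1 - d) ^ 2).
  2: { rewrite hab. field. split; [rewrite <- hab; exact h1|lra]. }
  rewrite hab.
  match goal with |- @eq _ ?a ?b => change (@eq R a b) end.
  generalize (ln ((1 + d + d ^ 2) / (1 - d) ^ 2)) (atan (sqrt 3 * d / (2 + d))) (sqrt 3).
  intros l t r. field. repeat split; auto.
  - rewrite <- hab. exact h3.
  - replace (27 * (1 - d ^ 3) ^ 2 - 4 * (-27 * d ^ 3)) with (27 * (1 + d ^ 3) ^ 2) by ring.
    apply Rmult_integral_contrapositive. split; [lra|apply pow_nonzero; exact hd3'].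
Qed.

(** * Real cube roots *)

(** Reduces every later simplification of a cube root to a polynomial identity, whatever the signs
    of the radicands. *)
Lemma cbrt_eq (t y : R) : y ^ 3 = t -> cbrt t = y.
Proof.
  assert (hpos : forall z, 0 < z -> Rpower (z ^ 3) (1 / 3) = z).
  { intros z hz. rewrite <- Rpower_pow by exact hz. rewrite Rpower_mult.
    replace (INR 3 * (1 / 3)) with 1 by (simpl; field). apply Rpower_1; exact hz. }
  intros <-. unfold cbrt.
  destruct (total_order_T y 0) as [[h| ->]|h].
  - assert (0 < (- y) ^ 3) by (apply pow_lt; lra).
    assert (e : - y ^ 3 = (- y) ^ 3) by ring.
    destruct (Rlt_dec 0 (y ^ 3)); [lra|]. destruct (Rlt_dec (y ^ 3) 0); [|lra].
    rewrite e, hpos by lra. ring.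
  - replace (0 ^ 3) with 0 by ring. destruct (Rlt_dec 0 0); lra.
  - pose proof (pow_lt _ 3 h). destruct (Rlt_dec 0 (y ^ 3)); [apply hpos|]; lra.
Qed.

Lemma cbrt_cube (t : R) : cbrt t ^ 3 = t.
Proof.
  assert (hpos : forall z, 0 < z -> Rpower z (1 / 3) ^ 3 = z).
  { intros z hz. rewrite <- Rpower_pow by apply exp_pos. rewrite Rpower_mult.
    replace (1 / 3 * INR 3) with 1 by (simpl; field). apply Rpower_1; exact hz. }
  unfold cbrt. destruct (Rlt_dec 0 t) as [h|h]; [auto|].
  destruct (Rlt_dec t 0) as [h'|h'].
  - replace ((- Rpower (- t) (1 / 3)) ^ 3) with (- Rpower (- t) (1 / 3) ^ 3) by ring.
    rewrite hpos; lra.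
  - simpl. lra.
Qed.

(** * The golden ratio and Binet's formulas *)

Lemma sqrt5_sqr : sqrt 5 * sqrt 5 = 5.
Proof. apply sqrt_sqrt; lra. Qed.

Lemma alpha_sqr : alpha ^ 2 = alpha + 1.
Proof. unfold alpha. pose proof sqrt5_sqr. nra. Qed.

Lemma beta_sqr : beta ^ 2 = beta + 1.
Proof. unfold beta. pose proof sqrt5_sqr. nra. Qed.

Lemma alpha_beta : alpha * beta = -1.
Proof. unfold alpha, beta. pose proof sqrt5_sqr. nra. Qed.

Lemma sqrt5_bounds : 2.236 < sqrt 5 < 2.237.
Proof. pose proof sqrt5_sqr. pose proof (sqrt_pos 5). split; nra. Qed.

Lemma alpha_neq_0 : alpha <> 0.
Proof. unfold alpha. pose proof sqrt5_bounds. lra. Qed.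

Lemma beta_neq_0 : beta <> 0.
Proof. unfold beta. pose proof sqrt5_bounds. lra. Qed.

Lemma fibN_binet (n : nat) : fibN n = (alpha ^ n - beta ^ n) / sqrt 5.
Proof.
  pose proof sqrt5_bounds as hs.
  enough (H : fibN n = (alpha ^ n - beta ^ n) / sqrt 5 /\
              fibN (S n) = (alpha ^ S n - beta ^ S n) / sqrt 5) by apply H.
  induction n as [|n [IH1 IH2]].
  - split; simpl; [field; lra|]. unfold alpha, beta. field. lra.
  - split; [exact IH2|]. change (fibN (S (S n))) with (fibN (S n) + fibN n).
    rewrite IH1, IH2.
    replace (alpha ^ S (S n)) with (alpha ^ n * alpha ^ 2) by (simpl; ring).
    replace (beta ^ S (S n)) with (beta ^ n * beta ^ 2) by (simpl; ring).
    rewrite alpha_sqr, beta_sqr. simpl. field. lra.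
Qed.

Lemma lucN_binet (n : nat) : lucN n = alpha ^ n + beta ^ n.
Proof.
  enough (H : lucN n = alpha ^ n + beta ^ n /\ lucN (S n) = alpha ^ S n + beta ^ S n)
    by apply H.
  induction n as [|n [IH1 IH2]].
  - split; simpl; [ring|]. unfold alpha, beta. field.
  - split; [exact IH2|]. change (lucN (S (S n))) with (lucN (S n) + lucN n).
    rewrite IH1, IH2.
    replace (alpha ^ S (S n)) with (alpha ^ n * alpha ^ 2) by (simpl; ring).
    replace (beta ^ S (S n)) with (beta ^ n * beta ^ 2) by (simpl; ring).
    rewrite alpha_sqr, beta_sqr. simpl. ring.
Qed.

Lemma pow_inv_conj (n : nat) :
  / alpha ^ n = (-1) ^ n * beta ^ n /\ / beta ^ n = (-1) ^ n * alpha ^ n.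
Proof.
  pose proof alpha_neq_0 as ha. pose proof beta_neq_0 as hb.
  rewrite <- !pow_inv, <- !Rpow_mult_distr. split; f_equal.
  - apply Rmult_eq_reg_l with alpha; [|exact ha]. rewrite Rinv_r by exact ha.
    replace (alpha * (-1 * beta)) with (- (alpha * beta)) by ring. rewrite alpha_beta. ring.
  - apply Rmult_eq_reg_l with beta; [|exact hb]. rewrite Rinv_r by exact hb.
    replace (beta * (-1 * alpha)) with (- (alpha * beta)) by ring. rewrite alpha_beta. ring.
Qed.

Lemma powerRZ_m1_sqr (z : Z) : (-1) ^^ z * (-1) ^^ z = 1.
Proof.
  rewrite <- powerRZ_mult. replace (-1 * -1) with 1 by ring. apply powerRZ_R1.
Qed.

Lemma powerRZ_m1_opp (z : Z) : (-1) ^^ (- z) = (-1) ^^ z.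
Proof.
  rewrite powerRZ_neg'. apply Rmult_eq_reg_l with ((-1) ^^ z).
  - rewrite Rinv_r, powerRZ_m1_sqr; [ring|]. apply powerRZ_NOR; lra.
  - apply powerRZ_NOR; lra.
Qed.

Lemma Fib_binet (z : Z) : Fib z = (alpha ^^ z - beta ^^ z) / sqrt 5.
Proof.
  pose proof sqrt5_bounds as hs.
  destruct z as [|n|n]; simpl.
  - field. lra.
  - apply fibN_binet.
  (* Inversion swaps the two roots up to the sign [(-1)^n]; the swap inside the difference turns it
     into [(-1)^(n-1)]. *)
  - destruct (pow_inv_conj (Pos.to_nat n)) as [-> ->]. rewrite fibN_binet.
    destruct (Pos.to_nat n) as [|k] eqn:e; [pose proof (Pos2Nat.is_pos n); lia|].
    replace (S k - 1)%nat with k by lia. simpl. field. lra.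
Qed.

Lemma Luc_binet (z : Z) : Luc z = alpha ^^ z + beta ^^ z.
Proof.
  destruct z as [|n|n]; simpl.
  - ring.
  - apply lucN_binet.
  - destruct (pow_inv_conj (Pos.to_nat n)) as [-> ->]. rewrite lucN_binet. ring.
Qed.

(** * Size of Fibonacci numbers and the disc of convergence *)

Lemma fibN_pos (n : nat) : 0 < fibN (S n).
Proof.
  enough (H : 0 < fibN (S n) /\ 0 < fibN (S (S n))) by apply H.
  induction n as [|n [IH1 IH2]]; [simpl; lra|].
  split; [exact IH2|]. change (fibN (S (S (S n)))) with (fibN (S (S n)) + fibN (S n)). lra.
Qed.

Lemma fibN_ge_1 (n : nat) : 1 <= fibN (S n).
Proof.
  induction n as [|[|n] IH]; [simpl; lra..|].
  change (fibN (S (S (S n)))) with (fibN (S (S n)) + fibN (S n)).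
  pose proof (fibN_pos n). lra.
Qed.

Lemma fibN_le_pow_alpha (n : nat) : fibN (S n) <= alpha ^ n.
Proof.
  pose proof sqrt5_bounds as h5.
  enough (H : fibN (S n) <= alpha ^ n /\ fibN (S (S n)) <= alpha ^ S n) by apply H.
  induction n as [|n [IH1 IH2]].
  - unfold alpha; simpl; lra.
  - split; [exact IH2|]. change (fibN (S (S (S n)))) with (fibN (S (S n)) + fibN (S n)).
    replace (alpha ^ S (S n)) with (alpha ^ n * alpha ^ 2) by (simpl; ring).
    rewrite alpha_sqr. simpl in *. lra.
Qed.

(** Serves both roots: [n = -p], [m = p+q] gives the pair for [alpha], and exchanging [n] and [m]
    gives, after scaling, the pair for [beta]. The quotient of the two numbers is at least
    [alpha^(n+1)] in absolute value. *)
Lemma separated_fibN (n m : nat) : (2 <= n)%nat -> (2 <= m)%nat ->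
  separated (fibN m) ((-1) ^ (n - 1) * alpha ^ (n + m) * fibN n).
Proof.
  intros hn hm. pose proof sqrt5_bounds as h5.
  destruct m as [|m]; [lia|]. destruct n as [|n]; [lia|].
  replace (S n - 1)%nat with n by lia.
  pose proof (fibN_pos m) as h1. pose proof (fibN_le_pow_alpha m) as h2.
  pose proof (fibN_ge_1 n) as h3.
  set (y := fibN (S m)) in *.
  assert (ha : 1 < alpha) by (unfold alpha; lra).
  assert (hz : alpha ^ (n + 2) * y <= alpha ^ (S n + S m) * fibN (S n)).
  { replace (S n + S m)%nat with (n + 2 + m)%nat by lia. rewrite (pow_add _ (n + 2) m).
    assert (0 < alpha ^ (n + 2)) by (apply pow_lt; lra).
    apply Rle_trans with (alpha ^ (n + 2) * alpha ^ m); [apply Rmult_le_compat_l; lra|].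
    rewrite <- (Rmult_1_r (_ * alpha ^ m)) at 1. apply Rmult_le_compat_l; [|exact h3].
    apply Rmult_le_pos; apply pow_le; lra. }
  rewrite Rmult_assoc. set (z := alpha ^ (S n + S m) * fibN (S n)) in *.
  assert (hyz : y < z).
  { assert (1 < alpha ^ (n + 2)) by (apply Rlt_pow_R1; [exact ha|lia]). nra. }
  repeat split.
  - lra.
  - rewrite Rabs_mult, pow_1_abs, Rmult_1_l, !Rabs_pos_eq; lra.
  (* For [n = 2] the ratio is negative; otherwise it is at most [1/6 < 3 - 2 sqrt 2]. *)
  - rewrite !Rabs_mult, pow_1_abs, Rmult_1_l, !Rabs_pos_eq by lra.
    destruct n as [|[|n]]; [lia| |].
    + simpl. nra.
    + assert (h6 : 6 * y <= z).
      { eapply Rle_trans; [|exact hz]. apply Rmult_le_compat_r; [lra|].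
        replace (S (S n) + 2)%nat with (4 + n)%nat by lia. rewrite pow_add.
        assert (1 <= alpha ^ n) by (apply pow_R1_Rle; lra).
        assert (6 <= alpha ^ 4).
        { replace (alpha ^ 4) with ((alpha ^ 2) ^ 2) by ring. rewrite alpha_sqr.
          unfold alpha. nra. }
        nra. }
      assert (hs : (-1) ^ S (S n) = 1 \/ (-1) ^ S (S n) = -1).
      { destruct (Nat.Even_or_Odd (S (S n))) as [[k hk]|[k hk]]; rewrite hk.
        - left. apply pow_1_even.
        - right. rewrite Nat.add_1_r. apply pow_1_odd. }
      destruct hs as [->| ->]; nra.
Qed.

(** * The coefficients, logarithms and arctangents in terms of two cube roots *)

(** All radicands are monomials in [a^3] and [b^3], except [s^(q-3p)], from which the perfect cube
    [s^(-3p)] is extracted. *)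
Lemma cbrt_B_terms (p q : Z) (s : R) : s <> 0 ->
  let a := cbrt (Fib (p + q)) in
  let b := cbrt (s ^^ q) * cbrt (Fib p) in
  cbrt (s ^^ (q - 3 * p)) = cbrt (s ^^ q) / s ^^ p /\
  s ^^ q * Fib p = b ^ 3 /\ Fib (p + q) = a ^ 3 /\
  cbrt (s ^^ (4 * q) * Fib p ^ 4) = b ^ 4 /\
  cbrt (Fib (p + q) ^ 4) = a ^ 4 /\
  cbrt (s ^^ q * Fib p * Fib (p + q)) = b * a /\
  cbrt (s ^^ (2 * q) * Fib p ^ 2) = b ^ 2 /\
  cbrt (Fib (p + q) ^ 2) = a ^ 2.
Proof.
  intros hs a b.
  assert (ha : a ^ 3 = Fib (p + q)) by apply cbrt_cube.
  assert (hb : b ^ 3 = s ^^ q * Fib p) by (unfold b; rewrite Rpow_mult_distr, !cbrt_cube; ring).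
  replace (q - 3 * p)%Z with (q + - p + - p + - p)%Z by ring.
  replace (4 * q)%Z with (q + q + q + q)%Z by ring.
  replace (2 * q)%Z with (q + q)%Z by ring.
  rewrite !powerRZ_add, powerRZ_neg' by exact hs.
  pose proof (powerRZ_NOR s p hs) as hsp.
  repeat split; try (apply cbrt_eq); try (symmetry; assumption).
  - unfold Rdiv. rewrite Rpow_mult_distr, cbrt_cube. ring.
  - transitivity ((b ^ 3) ^ 4); [ring|rewrite hb; ring].
  - transitivity ((a ^ 3) ^ 4); [ring|rewrite ha; ring].
  - transitivity (b ^ 3 * a ^ 3); [ring|rewrite ha, hb; ring].
  - transitivity ((b ^ 3) ^ 2); [ring|rewrite hb; ring].
  - transitivity ((a ^ 3) ^ 2); [ring|rewrite ha; ring].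
Qed.

Lemma Bplus_eq (p q : Z) (s : R) : s <> 0 ->
  let a := cbrt (Fib (p + q)) in
  let b := cbrt (s ^^ q) * cbrt (Fib p) in
  Bplus p q s = cbrt (s ^^ q) / s ^^ p / (a ^ 3 + b ^ 3) ^ 3 *
     (b ^ 4 - 2 * a * b ^ 3 - 2 * a ^ 3 * b + a ^ 4).
Proof.
  intros hs a b. destruct (cbrt_B_terms p q s hs) as (h1 & h2 & h3 & h4 & h5 & h6 & h7 & h8).
  unfold Bplus. fold a b in h2, h3, h4, h5, h6, h7, h8.
  rewrite h1, h4, h5, h6, h7, h8, h2, h3.
  rewrite (Rplus_comm (b ^ 3)). unfold Rdiv. ring.
Qed.

(** The bracket [b^4 - a^4 + 2ab(b^2 - a^2)] factors as [(b-a)(b+a)^3]. It is antisymmetric in [a]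
    and [b], whereas that of [Bplus] is symmetric. *)
Lemma Bminus_eq (p q : Z) (s : R) : s <> 0 ->
  let a := cbrt (Fib (p + q)) in
  let b := cbrt (s ^^ q) * cbrt (Fib p) in
  Bminus p q s = cbrt (s ^^ q) / s ^^ p / (a ^ 3 + b ^ 3) ^ 3 *
     ((b - a) * (b + a) ^ 3).
Proof.
  intros hs a b. destruct (cbrt_B_terms p q s hs) as (h1 & h2 & h3 & h4 & h5 & h6 & h7 & h8).
  unfold Bminus. fold a b in h2, h3, h4, h5, h6, h7, h8.
  rewrite h1, h4, h5, h6, h7, h8, h2, h3.
  rewrite (Rplus_comm (b ^ 3)). unfold Rdiv. ring.
Qed.

Lemma powerRZ_mul_nat (x : R) (z : Z) (k : nat) :
  x <> 0 -> x ^^ (z * Z.of_nat k) = (x ^^ z) ^ k.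
Proof.
  intros hx. induction k as [|k IH]; [rewrite Z.mul_0_r; reflexivity|].
  rewrite Nat2Z.inj_succ, Z.mul_succ_r, powerRZ_add, IH by exact hx. simpl. ring.
Qed.

Lemma cbrt_alpha_beta (q : Z) : cbrt (alpha ^^ q) * cbrt (beta ^^ q) = (-1) ^^ q.
Proof.
  assert (h : cbrt ((-1) ^^ q) = (-1) ^^ q).
  { apply cbrt_eq. transitivity ((-1) ^^ q * (-1) ^^ q * (-1) ^^ q); [ring|].
    rewrite powerRZ_m1_sqr. ring. }
  rewrite <- h. symmetry. apply cbrt_eq.
  rewrite Rpow_mult_distr, !cbrt_cube, <- powerRZ_mult, alpha_beta. reflexivity.
Qed.

(** The two fractions differ by the factor [- alpha ^^ p] in numerator and denominator;
    [(alpha * beta) ^^ p] accounts for the sign [(-1) ^^ p]. *)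
Lemma G1_eq (p q : Z) :
  let a := cbrt (Fib (p + q)) in
  let b := cbrt (alpha ^^ q) * cbrt (Fib p) in
  b - a <> 0 -> a ^ 3 - b ^ 3 = beta ^^ p * Fib q ->
  G1 p q = ln ((b ^ 3 - a ^ 3) / (b - a) ^ 3).
Proof.
  intros a b hba hN. pose proof alpha_neq_0 as ha.
  pose proof (powerRZ_NOR _ p ha) as hu.
  unfold G1. f_equal.
  set (t := cbrt (alpha ^^ p)).
  assert (ht : t ^ 3 = alpha ^^ p) by apply cbrt_cube.
  replace (cbrt (alpha ^^ p * Fib (p + q))) with (t * a).
  2: { symmetry. apply cbrt_eq. rewrite Rpow_mult_distr, ht. unfold a.
       rewrite cbrt_cube. reflexivity. }
  replace (cbrt (alpha ^^ (p + q) * Fib p)) with (t * b).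
  2: { symmetry. apply cbrt_eq. unfold b. rewrite !Rpow_mult_distr, ht, !cbrt_cube.
       rewrite powerRZ_add by exact ha. ring. }
  replace ((t * a - t * b) ^ 3) with (- t ^ 3 * (b - a) ^ 3) by ring.
  rewrite ht. rewrite <- alpha_beta, powerRZ_mult.
  replace (b ^ 3 - a ^ 3) with (- (beta ^^ p * Fib q)) by lra.
  field. auto.
Qed.

(** Here the common factor is [alpha ^^ q = t ^ 3], and [t * a] becomes [(-1) ^^ q * cbrt (Fib p)]
    by [cbrt_alpha_beta]. *)
Lemma G2_eq (p q : Z) :
  let b := cbrt (Fib (p + q)) in
  let a := cbrt (beta ^^ q) * cbrt (Fib p) in
  b - a <> 0 -> b ^ 3 - a ^ 3 = alpha ^^ p * Fib q ->
  G2 p q = ln ((b ^ 3 - a ^ 3) / (b - a) ^ 3).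
Proof.
  intros b a hba hN. pose proof alpha_neq_0 as ha.
  pose proof (powerRZ_NOR _ q ha) as hu.
  unfold G2. f_equal.
  set (t := cbrt (alpha ^^ q)).
  assert (ht : t ^ 3 = alpha ^^ q) by apply cbrt_cube.
  replace (cbrt (alpha ^^ q * Fib (p + q))) with (t * b).
  2: { symmetry. apply cbrt_eq. rewrite Rpow_mult_distr, ht. unfold b.
       rewrite cbrt_cube. reflexivity. }
  replace ((-1) ^^ q * cbrt (Fib p)) with (t * a).
  2: { unfold a, t. rewrite <- Rmult_assoc. f_equal. rewrite <- cbrt_alpha_beta. ring. }
  replace ((t * b - t * a) ^ 3) with (t ^ 3 * (b - a) ^ 3) by ring.
  rewrite ht, hN, powerRZ_add by exact ha.
  field. auto.
Qed.

(** The fraction is expanded by [e * t], with [e] the sign [(-1) ^^ q]; [e * e = 1] gives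
    [cbrt (Fib p) = e * t * a]. *)
Lemma T2_eq (p q : Z) :
  let b := cbrt (Fib (p + q)) in
  let a := cbrt (beta ^^ q) * cbrt (Fib p) in
  2 * b + a <> 0 -> T2 p q = atan (sqrt 3 * a / (2 * b + a)).
Proof.
  intros b a hba. unfold T2. f_equal.
  pose proof (powerRZ_NOR _ q alpha_neq_0) as hu.
  set (t := cbrt (alpha ^^ q)).
  assert (ht : t ^ 3 = alpha ^^ q) by apply cbrt_cube.
  assert (ht0 : t <> 0) by (intros h; apply hu; rewrite <- ht, h; ring).
  replace (cbrt (alpha ^^ q * Fib (p + q))) with (t * b).
  2: { symmetry. apply cbrt_eq. rewrite Rpow_mult_distr, ht. unfold b.
       rewrite cbrt_cube. reflexivity. }
  assert (he : (-1) ^^ q * cbrt (Fib p) = t * a).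
  { unfold a, t. rewrite <- Rmult_assoc, cbrt_alpha_beta. reflexivity. }
  pose proof (powerRZ_m1_sqr q) as he2.
  set (e := (-1) ^^ q) in *.
  replace (cbrt (Fib p)) with (e * t * a).
  2: { rewrite Rmult_assoc, <- he, <- Rmult_assoc, he2. ring. }
  assert (e <> 0) by (intros h; rewrite h in he2; lra).
  replace (2 * e * (t * b) + e * t * a) with (e * t * (2 * b + a)) by ring.
  field. auto.
Qed.

(** * Specialisation to [alpha] and [beta] *)

(** By Binet's formula one of the two powers with exponent [p+q] cancels. This makes the difference
    of cubes in [icb_sum] a multiple of [Fib q]. *)
Lemma Fib_sub (p q : Z) :
  Fib (p + q) - alpha ^^ q * Fib p = beta ^^ p * Fib q /\
  Fib (p + q) - beta ^^ q * Fib p = alpha ^^ p * Fib q.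
Proof.
  pose proof sqrt5_bounds. rewrite !Fib_binet.
  rewrite !powerRZ_add by (apply alpha_neq_0 || apply beta_neq_0).
  split; field; lra.
Qed.

Lemma Fib_separated (p q : Z) : (p <= -2)%Z -> (2 <= p + q)%Z ->
  separated (Fib (p + q)) (alpha ^^ q * Fib p) /\
  separated (beta ^^ q * Fib p) (Fib (p + q)).
Proof.
  intros hp hpq.
  set (n := Z.to_nat (- p)). set (m := Z.to_nat (p + q)).
  assert (hn : (2 <= n)%nat) by (unfold n; lia).
  assert (hm : (2 <= m)%nat) by (unfold m; lia).
  assert (hP : Fib p = (-1) ^ (n - 1) * fibN n).
  { unfold n. destruct p as [|p|p]; [lia|lia|]. reflexivity. }
  assert (hA : Fib (p + q) = fibN m).
  { unfold m. destruct (p + q)%Z as [|r|r]; [lia| |lia]. reflexivity. }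
  assert (hq : forall x, x ^^ q = x ^ (n + m)).
  { intros x. rewrite pow_powerRZ. f_equal. unfold n, m. lia. }
  rewrite hP, hA, !hq. split.
  - replace (alpha ^ (n + m) * ((-1) ^ (n - 1) * fibN n)) with
      ((-1) ^ (n - 1) * alpha ^ (n + m) * fibN n) by ring.
    apply separated_fibN; assumption.
  - assert (ha : alpha ^ (n + m) <> 0) by (apply pow_nonzero, alpha_neq_0).
    assert (hm1 : forall k, (-1) ^ k * (-1) ^ k = 1).
    { intros k. rewrite <- Rpow_mult_distr. replace (-1 * -1) with 1 by ring. apply pow1. }
    (* The pair for [beta] is the instance with [n] and [m] exchanged, scaled by this factor;
       [/ alpha ^ (n + m)] is [beta ^ (n + m)] up to the sign [(-1)^(n+m)]. *)
    pose proof (separated_scal ((-1) ^ (m - 1) * / alpha ^ (n + m)) _ _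
       ltac:(apply Rmult_integral_contrapositive; split;
             [apply pow_nonzero; lra|apply Rinv_neq_0_compat; exact ha])
       (separated_fibN m n hm hn)) as H.
    replace (beta ^ (n + m) * ((-1) ^ (n - 1) * fibN n)) with
      ((-1) ^ (m - 1) * / alpha ^ (n + m) * fibN n).
    2: { rewrite (proj1 (pow_inv_conj (n + m))), pow_add.
         replace ((-1) ^ n) with (- (-1) ^ (n - 1)).
         2: { destruct n as [|k]; [lia|]. replace (S k - 1)%nat with k by lia. simpl; ring. }
         replace ((-1) ^ m) with (- (-1) ^ (m - 1)).
         2: { destruct m as [|k]; [lia|]. replace (S k - 1)%nat with k by lia. simpl; ring. }
         rewrite <- (Rmult_1_l (beta ^ _ * _)), <- (hm1 (m - 1)%nat). ring. }
    replace (fibN m) with ((-1) ^ (m - 1) * / alpha ^ (n + m) *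
        ((-1) ^ (m - 1) * alpha ^ (m + n) * fibN m)) at 1; [exact H|].
    rewrite (Nat.add_comm m n).
    transitivity ((-1) ^ (m - 1) * (-1) ^ (m - 1) * fibN m); [field; exact ha|].
    rewrite hm1. ring.
Qed.

(** Since [(x y)^(2p) = 1], the factor [x^(2p)] moves to the denominator as [y^(2p)], where
    [Fib_sub] recognises a squared difference. *)
Lemma summand_base (p q : Z) (x y N : R) : x * y = -1 -> N <> 0 ->
  - 1 * (27 * Fib p * Fib (p + q) / N ^ 2) * x ^^ (2 * p + q)
  = - 27 * (Fib (p + q) * (x ^^ q * Fib p)) / (y ^^ p * N) ^ 2.
Proof.
  intros hxy hN.
  assert (hx : x <> 0) by (intros ->; lra).
  assert (hy : y <> 0) by (intros ->; lra).
  pose proof (powerRZ_NOR _ p hy) as hv.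
  replace (2 * p + q)%Z with (p + p + q)%Z by ring. rewrite !powerRZ_add by exact hx.
  assert (h : x ^^ p * x ^^ p = / (y ^^ p) ^ 2).
  { apply Rmult_eq_reg_r with ((y ^^ p) ^ 2); [|apply pow_nonzero; exact hv].
    rewrite Rinv_l by (apply pow_nonzero; exact hv).
    transitivity ((x ^^ p * y ^^ p) * (x ^^ p * y ^^ p)); [ring|].
    rewrite <- !(powerRZ_mult p x y), hxy. apply powerRZ_m1_sqr. }
  rewrite h. field. auto.
Qed.

(** Treats both series at once: the Binet coefficients [l1], [l2] are [/ sqrt 5], [- / sqrt 5] for
    [Fib] and [1], [1] for [Luc]. *)
Lemma summand_eq (p q : Z) (X : Z -> R) (l1 l2 : R) (k : nat) : Fib q <> 0 ->
  (forall z, X z = l1 * alpha ^^ z + l2 * beta ^^ z) ->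
  summand p q X k =
    (-1) ^^ p * l1 * ((- 27 * (Fib (p + q) * (alpha ^^ q * Fib p))
                        / (beta ^^ p * Fib q) ^ 2) ^ k * icb k)
    + (-1) ^^ p * l2 * ((- 27 * (Fib (p + q) * (beta ^^ q * Fib p))
                        / (alpha ^^ p * Fib q) ^ 2) ^ k * icb k).
Proof.
  intros hN hX. pose proof alpha_neq_0 as ha. pose proof beta_neq_0 as hb.
  rewrite <- (summand_base p q alpha beta (Fib q) alpha_beta hN).
  rewrite <- (summand_base p q beta alpha (Fib q)) by (auto; rewrite <- alpha_beta; ring).
  unfold summand, icb. rewrite hX, !powerRZ_mul_nat by assumption.
  unfold Z.sub. rewrite powerRZ_add by lra. rewrite powerRZ_m1_opp, <- pow_powerRZ.
  rewrite !(Rpow_mult_distr (-1 * _)), !(Rpow_mult_distr (-1)). unfold Rdiv. ring.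
Qed.

(** * Surds, and the combination of the two conjugate sums *)

Lemma two_div_sqrt3 : 2 / sqrt 3 = 2 * sqrt 3 / 3.
Proof.
  pose proof (sqrt_lt_R0 3 ltac:(lra)).
  rewrite <- (sqrt_sqrt 3) at 3 by lra. field. lra.
Qed.

Lemma inv_sqrt5 : / sqrt 5 = sqrt 5 / 5.
Proof.
  pose proof sqrt5_bounds. rewrite <- sqrt5_sqr at 3. field. lra.
Qed.

Lemma sqrt15 : sqrt 15 = sqrt 5 * sqrt 3.
Proof. rewrite <- sqrt_mult by lra. f_equal. ring. Qed.

Theorem theorem10 (p q : Z) (hp : (p <= -2)%Z) (hq : (4 <= q)%Z)
  (hpq : (Z.abs q > Z.abs p + 1)%Z) :
  (exists s : R,
     is_series (fun n : nat => summand p q Fib (S n)) s /\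
     / (Fib q * cbrt (Fib p * Fib (p + q))) * s =
       4 * (-1) ^^ (p - 1) * cbrt (Fib (p + q) ^ 2 * Fib p ^ 2) *
         (Fib (p + q) ^ 2 - (-1) ^^ q * Fib p ^ 2) /
         ((Fib (p + q) + alpha ^^ q * Fib p) ^ 2 *
          (Fib (p + q) + beta ^^ q * Fib p) ^ 2)
       - 2 * sqrt 15 / 15 *
           (Bplus p q alpha * T1 p q + Bplus p q beta * T2 p q)
       + sqrt 5 / 15 *
           (Bminus p q alpha * G1 p q - Bminus p q beta * G2 p q))
  /\
  (exists s : R,
     is_series (fun n : nat => summand p q Luc (S n)) s /\
     / (Fib q * cbrt (Fib p * Fib (p + q))) * s =
       4 * (-1) ^^ (p - q - 1) * cbrt (Fib (p + q) ^ 2 * Fib p ^ 2) / Fib q *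
         ((Fib p ^ 2 * Luc q + (-1) ^^ q * Fib (p + q) ^ 2 * Luc q
           + 4 * Fib p * Fib (p + q)) /
          ((Fib (p + q) + alpha ^^ q * Fib p) ^ 2 *
           (Fib (p + q) + beta ^^ q * Fib p) ^ 2))
       - 2 / sqrt 3 *
           (Bplus p q alpha * T1 p q - Bplus p q beta * T2 p q)
       + 1 / 3 *
           (Bminus p q alpha * G1 p q + Bminus p q beta * G2 p q)).
Proof.
  assert (hs5 : sqrt 5 <> 0) by (pose proof sqrt5_bounds; lra).
  (* As [p < 0 < q], the hypothesis on absolute values amounts to [2 <= p + q]. *)
  destruct (Fib_separated p q hp ltac:(lia)) as [sep1 sep2].
  destruct (Fib_sub p q) as [sub1 sub2].
  pose proof (Bplus_eq p q alpha alpha_neq_0) as Bp1.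
  pose proof (Bplus_eq p q beta beta_neq_0) as Bp2.
  pose proof (Bminus_eq p q alpha alpha_neq_0) as Bm1.
  pose proof (Bminus_eq p q beta beta_neq_0) as Bm2.
  pose proof (G1_eq p q) as hG1. pose proof (G2_eq p q) as hG2.
  pose proof (T2_eq p q) as hT2.
  assert (hT1 : T1 p q = atan (sqrt 3 * cbrt (Fib (p + q)) /
      (2 * (cbrt (alpha ^^ q) * cbrt (Fib p)) + cbrt (Fib (p + q))))).
  { unfold T1. do 3 f_equal. f_equal. apply cbrt_eq.
    rewrite Rpow_mult_distr, !cbrt_cube. reflexivity. }
  pose proof (fun X l1 l2 k => summand_eq p q X l1 l2 k) as hsum.
  assert (huv : alpha ^^ p * beta ^^ p = (-1) ^^ p)
    by (rewrite <- powerRZ_mult, alpha_beta; reflexivity).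
  assert (hgh : alpha ^^ q * beta ^^ q = (-1) ^^ q)
    by (rewrite <- powerRZ_mult, alpha_beta; reflexivity).
  pose proof (powerRZ_NOR _ p alpha_neq_0) as hu.
  pose proof (powerRZ_NOR _ p beta_neq_0) as hv.
  pose proof (powerRZ_m1_sqr p) as hdel. pose proof (powerRZ_m1_sqr q) as heps.
  pose proof (Fib_binet q) as hN. pose proof (Luc_binet q) as hL.
  replace ((-1) ^^ (p - 1)) with (- (-1) ^^ p).
  2: { unfold Z.sub. rewrite powerRZ_add by lra. simpl. field. }
  replace ((-1) ^^ (p - q - 1)) with (- ((-1) ^^ p * (-1) ^^ q)).
  2: { unfold Z.sub. rewrite !powerRZ_add, powerRZ_m1_opp by lra. simpl. field. }
  pose proof (cbrt_cube (Fib (p + q))) as ha. pose proof (cbrt_cube (Fib p)) as hc.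
  pose proof (cbrt_cube (alpha ^^ q)) as hg. pose proof (cbrt_cube (beta ^^ q)) as hh.
  replace (cbrt (Fib p * Fib (p + q))) with (cbrt (Fib (p + q)) * cbrt (Fib p)).
  2: { symmetry. apply cbrt_eq. rewrite Rpow_mult_distr, ha, hc. ring. }
  replace (cbrt (Fib (p + q) ^ 2 * Fib p ^ 2))
    with (cbrt (Fib (p + q)) ^ 2 * cbrt (Fib p) ^ 2).
  2: { symmetry. apply cbrt_eq. rewrite <- ha at 2. rewrite <- hc at 2. ring. }
  cbv zeta in *.
  set (a := cbrt (Fib (p + q))) in *. set (c := cbrt (Fib p)) in *.
  set (g := cbrt (alpha ^^ q)) in *. set (h := cbrt (beta ^^ q)) in *.
  rewrite <- ha, <- hc, <- hg in sep1. rewrite <- ha, <- hc, <- hh in sep2.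
  rewrite <- ha, <- hc, <- hg in sub1. rewrite <- ha, <- hc, <- hh in sub2.
  rewrite <- Rpow_mult_distr in sep1, sep2, sub1, sub2.
  pose proof (is_series_icb_sum _ _ sep1) as ser1.
  pose proof (is_series_icb_sum _ _ sep2) as ser2.
  destruct (separated_cube _ _ sep1) as (a0 & gc0 & hba1 & hb2a1 & hS1 & hD1 & _).
  destruct (separated_cube _ _ sep2) as (hc0 & _ & hba2 & hb2a2 & hS2 & hD2 & _).
  specialize (hG1 hba1 sub1). specialize (hG2 hba2 sub2). specialize (hT2 hb2a2).
  assert (hN0 : Fib q <> 0).
  { intros e. apply hD2. rewrite sub2, e. ring. }
  assert (c0 : c <> 0) by (intros e; apply gc0; rewrite e; ring).
  assert (g0 : g <> 0) by (intros e; apply gc0; rewrite e; ring).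
  assert (h0 : h <> 0) by (intros e; apply hc0; rewrite e; ring).
  (* From here the cube roots are opaque reals governed by the recorded equations, and what remains
     is rational algebra. *)
  clearbody a c g h.
  assert (hiu : / alpha ^^ p = (-1) ^^ p * beta ^^ p).
  { apply Rmult_eq_reg_l with (alpha ^^ p); [|exact hu]. rewrite Rinv_r by exact hu.
    rewrite <- hdel. rewrite <- huv at 1. ring. }
  assert (hiv : / beta ^^ p = (-1) ^^ p * alpha ^^ p).
  { apply Rmult_eq_reg_l with (beta ^^ p); [|exact hv]. rewrite Rinv_r by exact hv.
    rewrite <- hdel. rewrite <- huv at 1. ring. }
  assert (E1 : / (Fib q * (a * c)) * ((-1) ^^ p * icb_sum a (g * c)) =
     - 4 * (-1) ^^ p * (a ^ 2 * c ^ 2) * g ^ 3 / (Fib q * (a ^ 3 + (g * c) ^ 3) ^ 2)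
     - 2 / sqrt 3 * (Bplus p q alpha * T1 p q) + 1 / 3 * (Bminus p q alpha * G1 p q)).
  { unfold icb_sum. rewrite <- hG1, <- hT1, two_div_sqrt3, Bp1, Bm1.
    replace ((g * c) ^ 3 - a ^ 3) with (- (beta ^^ p * Fib q)) by (rewrite <- sub1; ring).
    unfold Rdiv. rewrite hiu. clear - hS1 a0 c0 hN0. field. auto. }
  (* The cube roots now enter in the opposite order. The prefactor changes sign relative to [E1], so
     the arctangent term, whose bracket is symmetric, flips sign, while the logarithm term, whose
     bracket is antisymmetric, keeps it. *)
  assert (E2 : / (Fib q * (a * c)) * ((-1) ^^ p * icb_sum (h * c) a) =
     - 4 * (-1) ^^ p * (a ^ 2 * c ^ 2) * h ^ 3 / (Fib q * (a ^ 3 + (h * c) ^ 3) ^ 2)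
     + 2 / sqrt 3 * (Bplus p q beta * T2 p q) + 1 / 3 * (Bminus p q beta * G2 p q)).
  { unfold icb_sum. rewrite <- hG2, <- hT2, two_div_sqrt3, Bp2, Bm2.
    rewrite sub2. rewrite (Rplus_comm ((h * c) ^ 3)) in *.
    unfold Rdiv. rewrite hiv. clear - hS2 a0 c0 hN0. field. auto. }
  assert (hX : forall (X : Z -> R) (l1 l2 : R),
    (forall z, X z = l1 * alpha ^^ z + l2 * beta ^^ z) ->
    is_series (fun n => summand p q X (S n))
      ((-1) ^^ p * l1 * icb_sum a (g * c) + (-1) ^^ p * l2 * icb_sum (h * c) a)).
  { intros X l1 l2 hl.
    apply (is_series_ext (fun n => plus
      (scal ((-1) ^^ p * l1) ((- 27 * (a ^ 3 * (g * c) ^ 3) / ((g * c) ^ 3 - a ^ 3) ^ 2) ^ S n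
         * icb (S n)))
      (scal ((-1) ^^ p * l2) ((- 27 * ((h * c) ^ 3 * a ^ 3) / (a ^ 3 - (h * c) ^ 3) ^ 2) ^ S n
         * icb (S n))))).
    - intros n. rewrite (hsum X l1 l2 (S n) hN0 hl).
      rewrite <- ha, <- hc, <- hg, <- hh, <- sub1, <- sub2,
        <- !(Rpow_mult_distr g c), <- !(Rpow_mult_distr h c).
      rewrite (Rmult_comm ((h * c) ^ 3)).
      replace (((g * c) ^ 3 - a ^ 3) ^ 2) with ((a ^ 3 - (g * c) ^ 3) ^ 2) by ring.
      reflexivity.
    - exact (is_series_plus _ _ _ _ (is_series_scal _ _ _ ser1) (is_series_scal _ _ _ ser2)). }
  rewrite <- ha, <- hc, hL, <- hgh, <- hg, <- hh, <- !(Rpow_mult_distr g c),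
    <- !(Rpow_mult_distr h c).
  rewrite <- hg, <- hh in hN.
  assert (hgh0 : g ^ 3 - h ^ 3 <> 0).
  { intros e. apply hN0. rewrite hN, e. unfold Rdiv. ring. }
  assert (hS2' : a ^ 3 + (h * c) ^ 3 <> 0) by (rewrite Rplus_comm; exact hS2).
  split.
  - eexists. split.
    + apply (hX Fib (/ sqrt 5) (- / sqrt 5)).
      intros z. rewrite Fib_binet. field. exact hs5.
    + match goal with |- ?l = _ => replace l with
        (/ sqrt 5 * (/ (Fib q * (a * c)) * ((-1) ^^ p * icb_sum a (g * c)))
         - / sqrt 5 * (/ (Fib q * (a * c)) * ((-1) ^^ p * icb_sum (h * c) a))) end.
      2: { field. auto. }
      rewrite E1, E2.
      (* Over a common denominator the cross terms cancel and [g^3 - h^3] factors out; it equals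
         [sqrt 5 * Fib q], which removes [Fib q] from the denominator. *)
      assert (RF : 4 * - (-1) ^^ p * (a ^ 2 * c ^ 2)
          * ((a ^ 3) ^ 2 - g ^ 3 * h ^ 3 * (c ^ 3) ^ 2)
          / ((a ^ 3 + (g * c) ^ 3) ^ 2 * (a ^ 3 + (h * c) ^ 3) ^ 2) =
        / sqrt 5 * (- 4 * (-1) ^^ p * (a ^ 2 * c ^ 2) * g ^ 3
                      / (Fib q * (a ^ 3 + (g * c) ^ 3) ^ 2))
        - / sqrt 5 * (- 4 * (-1) ^^ p * (a ^ 2 * c ^ 2) * h ^ 3
                      / (Fib q * (a ^ 3 + (h * c) ^ 3) ^ 2))).
      { rewrite hN. clear - hS1 hS2' hgh0 hs5. field. auto. }
      rewrite RF, sqrt15, two_div_sqrt3, inv_sqrt5. field. auto.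
  - eexists. split.
    + apply (hX Luc 1 1). intros z. rewrite Luc_binet. ring.
    + match goal with |- ?l = _ => replace l with
        (/ (Fib q * (a * c)) * ((-1) ^^ p * icb_sum a (g * c))
         + / (Fib q * (a * c)) * ((-1) ^^ p * icb_sum (h * c) a)) end.
      2: { field. auto. }
      rewrite E1, E2.
      assert (RL : 4 * - ((-1) ^^ p * (g ^ 3 * h ^ 3)) * (a ^ 2 * c ^ 2) / Fib q
          * (((c ^ 3) ^ 2 * (g ^ 3 + h ^ 3) + g ^ 3 * h ^ 3 * (a ^ 3) ^ 2 * (g ^ 3 + h ^ 3)
              + 4 * c ^ 3 * a ^ 3)
          / ((a ^ 3 + (g * c) ^ 3) ^ 2 * (a ^ 3 + (h * c) ^ 3) ^ 2)) =
        - 4 * (-1) ^^ p * (a ^ 2 * c ^ 2) * g ^ 3 / (Fib q * (a ^ 3 + (g * c) ^ 3) ^ 2)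
        + - 4 * (-1) ^^ p * (a ^ 2 * c ^ 2) * h ^ 3 / (Fib q * (a ^ 3 + (h * c) ^ 3) ^ 2)).
      { rewrite <- hgh, <- hg, <- hh in heps.
        (* For the Lucas sum the cross terms add up to the term with coefficient 4. The prefactor
           [g^3 h^3 = (-1)^q] squares to 1, which frees the [a] term of its sign. *)
        assert (hnum : g ^ 3 * h ^ 3 * ((c ^ 3) ^ 2 * (g ^ 3 + h ^ 3)
             + g ^ 3 * h ^ 3 * (a ^ 3) ^ 2 * (g ^ 3 + h ^ 3) + 4 * c ^ 3 * a ^ 3)
             = g ^ 3 * h ^ 3 * ((c ^ 3) ^ 2 * (g ^ 3 + h ^ 3) + 4 * c ^ 3 * a ^ 3)
               + (a ^ 3) ^ 2 * (g ^ 3 + h ^ 3)).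
        { rewrite <- (Rmult_1_l ((a ^ 3) ^ 2 * (g ^ 3 + h ^ 3))), <- heps. ring. }
        match goal with |- 4 * - (?d * ?e) * ?x / ?n * (?m / ?s) = _ =>
          replace (4 * - (d * e) * x / n * (m / s)) with (- 4 * d * x / n * ((e * m) / s))
            by (unfold Rdiv; ring) end.
        rewrite hnum. clear - hS1 hS2' hN0. field. auto. }
      rewrite RL, two_div_sqrt3. field. auto.
Qed.
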